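(* Let $t\in\{2,\dots,T-1\}$, let $\boldsymbol{x}_{t-1}$ be a feasible previous-stage state and let $\boldsymbol{\xi}_t\in\Xi_t$. Suppose that the ambiguity sets in the value-function recursion are of Type 2, $\mathcal{P}_{t+1}(\boldsymbol{x}_t)=\mathcal{P}^{D_2}_{t+1}(\boldsymbol{x}_t)$ with $$\mathcal{P}^{D_2}_{t+1}(\boldsymbol{x}_t)=\Big\{\boldsymbol{p}\in\mathbb{R}_+^K:\ \sum_{k=1}^Kp_k=1,\ \sum_{k=1}^Kp_k\boldsymbol{\xi}_{t+1}^k=\boldsymbol{\mu}(\boldsymbol{x}_t),\ \sum_{k=1}^Kp_k(\boldsymbol{\xi}_{t+1}^k-\boldsymbol{\mu}(\boldsymbol{x}_t))(\boldsymbol{\xi}_{t+1}^k-\boldsymbol{\mu}(\boldsymbol{x}_t))^{\mathsf T}=\boldsymbol{\Sigma}(\boldsymbol{x}_t)\Big\},$$ and that $\mathcal{P}^{D_2}_{t+1}(\boldsymbol{x}_t)\ne\emptyset$ for every feasible $\boldsymbol{x}_t\in\hat X_t(\boldsymbol{x}_{t-1},\boldsymbol{\xi}_t)$. Then $Q_t(\boldsymbol{x}_{t-1},\boldsymbol{\xi}_t)$ equals the optimal value of $$\begin{aligned} \min_{\boldsymbol{x}_t,\boldsymbol{y}_t,s,\boldsymbol{u},\boldsymbol{Y}}\quad & g_t(\boldsymbol{x}_t,\boldsymbol{y}_t)+s+\boldsymbol{u}^{\mathsf T}\boldsymbol{\mu}(\boldsymbol{x}_t)+\boldsymbol{\Sigma}(\boldsymbol{x}_t)\bullet\boldsymbol{Y}\\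 \text{s.t.}\quad & s+\boldsymbol{u}^{\mathsf T}\boldsymbol{\xi}_{t+1}^k+(\boldsymbol{\xi}_{t+1}^k-\boldsymbol{\mu}(\boldsymbol{x}_t))(\boldsymbol{\xi}_{t+1}^k-\boldsymbol{\mu}(\boldsymbol{x}_t))^{\mathsf T}\bullet\boldsymbol{Y}\ge Q_{t+1}(\boldsymbol{x}_t,\boldsymbol{\xi}_{t+1}^k),\quad k=1,\dots,K,\\ & (\boldsymbol{x}_t,\boldsymbol{y}_t)\in X_t(\boldsymbol{x}_{t-1},\boldsymbol{\xi}_t),\quad s\in\mathbb{R},\ \boldsymbol{u}\in\mathbb{R}^J,\ \boldsymbol{Y}\in\mathbb{R}^{J\times J}. \end{aligned}$$
   Context: Setting (multistage decision-dependent distributionally robust mixed-integer program). Fix positive integers $T,I,J,K$. At each stage $t\in\{1,\dots,T\}$ the decisions are a binary state variable $\boldsymbol{x}_t\in\{0,1\}^I$ and a stage variable $\boldsymbol{y}_t\in\mathbb{R}^{I\times J}$ (components integer or continuous). $\boldsymbol{\xi}_1$ is deterministic; for $t\ge2$, $\boldsymbol{\xi}_t$ is a random vector with finite, decision-independent support $\Xi_t=\{\boldsymbol{\xi}_t^1,\dots,\boldsymbol{\xi}_t^K\}\subset\mathbb{R}^J$, and the $\boldsymbol{\xi}_t$ are stage-wise independent. The cost $g_t(\boldsymbol{x}_t,\boldsymbol{y}_t)$ is linear. The feasible set $X_t(\boldsymbol{x}_{t-1},\boldsymbol{\xi}_t)\subset\{0,1\}^I\times\mathbb{R}^{I\times J}$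 is a non-empty compact mixed-integer polyhedral set for every feasible $\boldsymbol{x}_{t-1}$ and every realization $\boldsymbol{\xi}_t$ (complete recourse: every stage subproblem is always feasible). $\hat X_t(\boldsymbol{x}_{t-1},\boldsymbol{\xi}_t)$ denotes the projection of $X_t(\boldsymbol{x}_{t-1},\boldsymbol{\xi}_t)$ onto the $\boldsymbol{x}_t$-space. A probability distribution on $\Xi_{t+1}$ is identified with a vector $\boldsymbol{p}=(p_1,\dots,p_K)$, $p_k$ being the probability of $\boldsymbol{\xi}_{t+1}^k$. For each stage, $\mathcal{P}_{t+1}(\boldsymbol{x}_t)$ is a set of such distributions (ambiguity set) depending on $\boldsymbol{x}_t$. Value functions are defined by $$Q_T(\boldsymbol{x}_{T-1},\boldsymbol{\xi}_T)=\min_{(\boldsymbol{x}_T,\boldsymbol{y}_T)\in X_T(\boldsymbol{x}_{T-1},\boldsymbol{\xi}_T)} g_T(\boldsymbol{x}_T,\boldsymbol{y}_T),$$ and for $t=2,\dots,T-1$ by the Bellman equation $$Q_t(\boldsymbol{x}_{t-1},\boldsymbol{\xi}_t)=\min_{(\boldsymbol{x}_t,\boldsymbol{y}_t)\in X_t(\boldsymbol{x}_{t-1},\boldsymbol{\xi}_t)}\Big\{g_t(\boldsymbol{x}_t,\boldsymbol{y}_t)+\max_{\boldsymbol{p}\in\mathcal{P}_{t+1}(\boldsymbol{x}_t)}\sum_{k=1}^Kp_k\,Q_{t+1}(\boldsymbol{x}_t,\boldsymbol{\xi}_{t+1}^k)\Big\}.$$ Type 2 data: $\boldsymbol{\mu}(\boldsymbol{x}_t)\in\mathbb{R}^J$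 and $\boldsymbol{\Sigma}(\boldsymbol{x}_t)\in\mathbb{R}^{J\times J}$ are the given decision-dependent empirical mean vector and covariance matrix. $\boldsymbol{A}\bullet\boldsymbol{B}=\mathrm{trace}(\boldsymbol{A}^{\mathsf T}\boldsymbol{B})$ is the Frobenius inner product. *)

(* Defs.v *)
(* MathComp-Analysis, over an arbitrary realType. *)
From HB Require Import structures.
From mathcomp Require Import all_boot all_order all_algebra.
From mathcomp Require Import all_classical all_reals all_analysis.

Set Implicit Arguments.
Unset Strict Implicit.
Unset Printing Implicit Defensive.

Import Order.TTheory GRing.Theory Num.Theory.
Import numFieldNormedType.Exports.

Local Open Scope classical_set_scope.
Local Open Scope ring_scope.

Definition dotmx (R : realType) (n : nat) (u v : 'cV[R]_n) : R :=
  (u^T *m v) 0 0.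

Definition frobenius (R : realType) (m n : nat) (A B : 'M[R]_(m, n)) : R :=
  \tr (A^T *m B).

Definition binary (R : realType) (n : nat) (x : 'rV[R]_n) : Prop :=
  forall i, x 0 i = 0 \/ x 0 i = 1.

Definition simplex (R : realType) (K : nat) : set 'rV[R]_K :=
  [set p | (forall k, 0 <= p 0 k) /\ \sum_k p 0 k = 1].
Arguments simplex : clear implicits.

(* [Z] is the set of positions of [y] that carry an integrality constraint. *)
Definition mixed_integer_polyhedral (R : realType) (I J : nat)
    (Z : {set 'I_I * 'I_J}) (S : set ('rV[R]_I * 'M[R]_(I, J))) : Prop :=
  exists (m : nat) (A : 'I_m -> 'rV[R]_I) (B : 'I_m -> 'M[R]_(I, J))
         (c : 'I_m -> R),
    S = [set xy : 'rV[R]_I * 'M[R]_(I, J) |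
          [/\ binary xy.1,
              (forall i j, (i, j) \in Z -> xy.2 i j \is a Num.int) &
              forall l, frobenius (A l) xy.1 + frobenius (B l) xy.2 <= c l]].

(* Stages are numbered 1, ..., horizon, and the stage-indexed fields are only
   meaningful there: the support of stage 1 is {xi1}, that of a stage t >= 2
   is {xi t k | k}; feas t x z is the feasible set X_t(x, z) for the previous
   state x and the realization z (x0 is the state preceding stage 1), with
   integrality constraints on the components intY t of y_t, and
   ambiguity t.+1 x is the ambiguity set P_{t+1}(x). *)
Record program (R : realType) (I J K : nat) := Program {
  horizon : nat;
  x0 : 'rV[R]_I;
  xi1 : 'cV[R]_J;
  xi : nat -> 'I_K -> 'cV[R]_J;
  cost : nat -> {scalar ('rV[R]_I * 'M[R]_(I, J))%type};
  feas : nat -> 'rV[R]_I -> 'cV[R]_J -> set ('rV[R]_I * 'M[R]_(I, J));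
  intY : nat -> {set 'I_I * 'I_J};
  ambiguity : nat -> 'rV[R]_I -> set 'rV[R]_K
}.

Section Program.
Context (R : realType) (I J K : nat) (P : program R I J K).

Definition realizations (t : nat) : set 'cV[R]_J :=
  if t == 1%N then [set xi1 P] else range (xi P t).

Definition Xhat (t : nat) (x : 'rV[R]_I) (z : 'cV[R]_J) : set 'rV[R]_I :=
  fst @` feas P t x z.

(* States reachable at stage t along some realization of the uncertainty. *)
Fixpoint feasible_state (t : nat) : set 'rV[R]_I :=
  if t is t'.+1 then
    [set x | exists x' z,
       [/\ feasible_state t' x', realizations t'.+1 z & Xhat t'.+1 x' z x]]
  else [set x0 P].

Definition well_posed : Prop :=
  (forall t x z, (1 <= t <= horizon P)%N ->
     feasible_state t.-1 x -> realizations t z ->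
     [/\ feas P t x z !=set0, compact (feas P t x z) &
         mixed_integer_polyhedral (intY P t) (feas P t x z)]) /\
  (forall t x, (1 <= t < horizon P)%N ->
     feasible_state t x -> ambiguity P t.+1 x `<=` simplex R K).

Local Open Scope ereal_scope.

(* [value_rec n t] is the value function of stage t when n stages follow it.
   Optimal values live in the extended reals: an empty ambiguity set
   contributes -oo, and the products below use 0 * -oo = 0. *)
Fixpoint value_rec (n t : nat) (x : 'rV[R]_I) (z : 'cV[R]_J) : \bar R :=
  if n is n'.+1 then
    ereal_inf [set (cost P t xy)%:E +
        ereal_sup [set \sum_(k < K) (p 0%R k)%:E *
                                    value_rec n' t.+1 xy.1 (xi P t.+1 k)
                  | p in ambiguity P t.+1 xy.1]
      | xy in feas P t x z]
  else ereal_inf [set (cost P t xy)%:E | xy in feas P t x z].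

Definition Q (t : nat) := value_rec (horizon P - t) t.

Lemma Q_horizon (x : 'rV[R]_I) (z : 'cV[R]_J) :
  Q (horizon P) x z =
  ereal_inf [set (cost P (horizon P) xy)%:E | xy in feas P (horizon P) x z].
Proof. by rewrite /Q subnn. Qed.

Lemma Q_bellman (t : nat) (x : 'rV[R]_I) (z : 'cV[R]_J) :
  (t < horizon P)%N ->
  Q t x z =
  ereal_inf [set (cost P t xy)%:E +
      ereal_sup [set \sum_(k < K) (p 0%R k)%:E * Q t.+1 xy.1 (xi P t.+1 k)
                | p in ambiguity P t.+1 xy.1]
    | xy in feas P t x z].
Proof. by move=> tT; rewrite /Q -(subnSK tT). Qed.

Local Close Scope ereal_scope.

Section Type2.
Context (mu : 'rV[R]_I -> 'cV[R]_J) (Sigma : 'rV[R]_I -> 'M[R]_J).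

Definition scatter (x : 'rV[R]_I) (z : 'cV[R]_J) : 'M[R]_J :=
  (z - mu x) *m (z - mu x)^T.

Definition type2_ambiguity (t : nat) (x : 'rV[R]_I) : set 'rV[R]_K :=
  [set p | [/\ simplex R K p,
               \sum_k p 0 k *: xi P t k = mu x &
               \sum_k p 0 k *: scatter x (xi P t k) = Sigma x]].

Definition type2_objective_values (t : nat) (x : 'rV[R]_I) (z : 'cV[R]_J) :
    set (\bar R) :=
  [set v | exists (xt : 'rV[R]_I) (yt : 'M[R]_(I, J))
                  (s : R) (u : 'cV[R]_J) (Y : 'M[R]_J),
     [/\ (forall k, (Q t.+1 xt (xi P t.+1 k) <=
                     (s + dotmx u (xi P t.+1 k)
                      + frobenius (scatter xt (xi P t.+1 k)) Y)%:E)%E),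
         feas P t x z (xt, yt) &
         v = (cost P t (xt, yt) + s + dotmx u (mu xt)
              + frobenius (Sigma xt) Y)%:E]].

End Type2.
End Program.

(* [v] is the optimal value of the minimization problem whose feasible points
   have objective values [S]; a finite optimal value is moreover attained. *)
Definition is_optimal_value (R : realType) (S : set (\bar R)) (v : \bar R) :
    Prop :=
  v = ereal_inf S /\ (v \is a fin_num -> S v).

(* Main.v *)
Require Import Defs.
From HB Require Import structures.
From mathcomp Require Import all_boot all_order all_algebra.
From mathcomp Require Import all_classical all_reals all_analysis.
From mathcomp Require Import ring lra.

(** Once the decision (x_t, y_t) is fixed, the inner maximization over the
    ambiguity set is a linear program in p whose constraints are the moment
    equations; s, u and Y are their multipliers, and the reformulation replaces
    the inner maximum by the minimum of the dual linear program.

    Three points need more than this remark.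

    - The dual minimum must be attained and not merely approached.  Farkas'
      lemma ([farkas]) is proved for linear forms on an arbitrary vector space,
      by induction on their number, and applied to the homogenized dual system
      together with the bound on its objective; [lp_dual_attained] follows.

    - The next-stage values may be -oo, because an ambiguity set of a later
      stage may be empty.  They are never +oo ([value_rec_lty]).  A scenario of
      value -oo imposes no dual constraint and, with 0 * -oo = 0, forces the
      weight 0 in every p of value above -oo; [type2_strong_duality] therefore
      drops these scenarios on both sides, and the restricted primal is then
      allowed to be infeasible, in which case the dual is unbounded.

    - A finite optimal value must be attained over (x_t, y_t) as well.  The
      inner maximum is an arbitrary function of x_t, but x_t is binary, hence
      this function is locally constant on the compact feasible set and the
      extreme value theorem applies ([binary_min_attained]). *)

Set Implicit Arguments.
Unset Strict Implicit.
Unset Printing Implicit Defensive.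

Import Order.TTheory GRing.Theory Num.Theory.
Import numFieldNormedType.Exports.

Local Open Scope classical_set_scope.
Local Open Scope ring_scope.

(** * Farkas' lemma and linear programming duality *)

(** Algebraic proof by induction on the number of forms.  If the form a_0
    cannot be dropped from the hypothesis, some v0 satisfies the other
    inequalities and has g v0 > 0, so a_0 v0 > 0.  Composing every form with
    the projection onto the kernel of a_0 along v0 removes a_0; the induction
    hypothesis gives g up to a multiple of a_0, whose coefficient is
    nonnegative by evaluation at v0. *)
Lemma farkas (R : realFieldType) (W : lmodType R) (m : nat)
    (a : 'I_m -> W -> R) (g : W -> R) :
  (forall i, scalar (a i)) -> scalar g ->
  (forall w, (forall i, a i w <= 0) -> g w <= 0) ->
  exists2 l : 'I_m -> R, forall i, 0 <= l i &
    forall w, g w = \sum_i l i * a i w.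
Proof.
elim: m a g => [|m IH] a g a_lin g_lin ag.
  have g_le0 w : g w <= 0 by apply: ag => -[].
  exists (fun=> 0) => // w; rewrite big_ord0; apply: le_anti; rewrite g_le0 /=.
  have gN : g (- w) = - g w.
    have g0 : g 0 = 0 by have := g_lin 1 0 0; rewrite scaler0 addr0 /=; lra.
    by have := g_lin (-1) w 0; rewrite addr0 g0 /= scaleN1r; lra.
  by rewrite -oppr_le0 -gN.
pose b i := a (lift ord0 i); pose e := a ord0.
have [bg|/existsNP[v0 /not_implyP[bv0 /negP]]] :=
    pselect (forall w, (forall i, b i w <= 0) -> g w <= 0).
  have [l l_ge0 gE] := IH b g (fun i => a_lin _) g_lin bg.
  exists (fun i => if unlift ord0 i is Some j then l j else 0).
    by move=> i; case: unliftP.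
  move=> w; rewrite big_ord_recl unlift_none mul0r add0r gE.
  by apply: eq_bigr => i _; rewrite liftK.
rewrite -ltNge => gv0.
have ev0 : 0 < e v0.
  rewrite ltNge; apply/negP => ev0; have /ag : forall i, a i v0 <= 0.
    by move=> i; case: (unliftP ord0 i) => [j|] ->; [exact: bv0|].
  by rewrite leNgt gv0.
pose r w := w - (e w / e v0) *: v0.
(* [r] is the projection onto the kernel of [e] along [v0]. *)
have rE f : scalar f -> forall w, f (r w) = f w - e w / e v0 * f v0.
  by move=> f_lin w; rewrite /r [w - _]addrC -scaleNr f_lin /= mulNr addrC.
have r_lin f : scalar f -> scalar (f \o r).
  by move=> f_lin k u v /=; rewrite !rE// f_lin [e (_ + _)]a_lin -/e /=; ring.
have [||w bw|l l_ge0 gE] := IH (fun i => b i \o r) (g \o r).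
- by move=> i; apply: r_lin; exact: a_lin.
- exact: r_lin.
- apply: ag => i; case: (unliftP ord0 i) => [j|] ->; first exact: bw.
  by rewrite -/e rE; [rewrite divfK ?gt_eqF// subrr|exact: a_lin].
pose l0 := (g v0 - \sum_i l i * b i v0) / e v0.
exists (fun i => if unlift ord0 i is Some j then l j else l0).
  move=> i; case: unliftP => [j _|_]; first exact: l_ge0.
  apply: divr_ge0 (ltW ev0); rewrite subr_ge0 (le_trans _ (ltW gv0))//.
  by apply: sumr_le0 => j _; apply: mulr_ge0_le0.
move=> w; rewrite big_ord_recl unlift_none -/e.
under eq_bigr do rewrite liftK -/(b _).
have := gE w; rewrite /= rE//.
under eq_bigr => i _ do rewrite (rE (b i) (a_lin _)).
under eq_bigr => i _ do rewrite mulrBr mulrCA.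
rewrite sumrB -mulr_sumr => /eqP; rewrite subr_eq => /eqP ->.
by rewrite /l0; ring.
Qed.

(** Farkas' lemma for the system a_i w >= q_i tau, b w <= c tau in (w, tau),
    with the claim tau <= 0: a solution with tau > 0 would rescale to the
    required w.  The multipliers expressing tau give a primal point when the
    weight of the objective inequality is positive, and otherwise contradict
    dual feasibility.  The primal program may be infeasible; every c is then
    reached, which is dual unboundedness. *)
Lemma lp_dual_attained (R : realFieldType) (W : lmodType R) (m : nat)
    (a : 'I_m -> W -> R) (b : W -> R) (q : 'I_m -> R) (c : R) :
  (forall i, scalar (a i)) -> scalar b ->
  (exists w, forall i, q i <= a i w) ->
  (forall p : 'I_m -> R, (forall i, 0 <= p i) ->
     (forall w, \sum_i p i * a i w = b w) -> \sum_i p i * q i <= c) ->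
  exists2 w, (forall i, q i <= a i w) & b w <= c.
Proof.
move=> a_lin b_lin [w0 qw0] pc; apply: contrapT => no_w.
have lin0 (f : W -> R) : scalar f -> f 0 = 0.
  by move=> f_lin; have := f_lin 1 0 0; rewrite scaler0 addr0 /=; lra.
have linZ (f : W -> R) k w : scalar f -> f (k *: w) = k * f w.
  by move=> f_lin; have := f_lin k w 0; rewrite addr0 lin0 //= addr0.
pose d (i : 'I_m.+1) (w : W * R^o) : R :=
  if unlift ord0 i is Some j then q j * w.2 - a j w.1 else b w.1 - c * w.2.
have [||w dw|l l_ge0 lE] := @farkas R (W * R^o)%type m.+1 d snd.
- move=> i k [u1 u2] [v1 v2]; rewrite /d; case: unliftP => [j|] _ /=;
    rewrite ?(a_lin, b_lin) /= (_ : k *: u2 = k * u2)//;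
    by move: u2 v2; rewrite /GRing.regular => u2 v2; ring.
- by [].
- rewrite leNgt; apply/negP => w_gt0; apply: no_w; exists (w.2^-1 *: w.1).
    move=> i; have := dw (lift ord0 i); rewrite /d liftK linZ//.
    by rewrite [w.2^-1 * _]mulrC ler_pdivlMr// subr_le0.
  by have := dw ord0; rewrite /d unlift_none linZ// [w.2^-1 * _]mulrC
    ler_pdivrMr// subr_le0.
pose p i := l (lift ord0 i).
have bE w : l ord0 * b w = \sum_i p i * a i w.
  have := lE (w, 0); rewrite big_ord_recl /d unlift_none /=.
  under eq_bigr do rewrite liftK mulr0 sub0r mulrN.
  by rewrite sumrN mulr0 subr0 => /esym/eqP; rewrite subr_eq0 => /eqP.
have qE : 1 + l ord0 * c = \sum_i p i * q i.
  have := lE (0, 1); rewrite big_ord_recl /d unlift_none /= lin0//.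
  under eq_bigr => i _ do rewrite liftK lin0// mulr1 subr0.
  by rewrite /p; lra.
have [l0|l0] := eqVneq (l ord0) 0.
  have : \sum_i p i * q i <= \sum_i p i * a i w0.
    by apply: ler_sum => i _; apply: ler_wpM2l (qw0 i); exact: l_ge0.
  by rewrite -bE -qE l0 !mul0r; lra.
have l0_gt0 : 0 < l ord0 by rewrite lt_def l0 l_ge0.
have scale (f : 'I_m -> R) :
    \sum_i p i / l ord0 * f i = (\sum_i p i * f i) / l ord0.
  by rewrite mulr_suml; apply: eq_bigr => i _; rewrite mulrAC.
have : \sum_i p i / l ord0 * q i <= c.
  apply: pc => [i|w]; first exact: divr_ge0 (l_ge0 _) (l_ge0 _).
  by rewrite scale -bE mulrAC divff// mul1r.
by rewrite scale ler_pdivrMr// -qE; lra.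
Qed.

(** * Attained minima with binary components *)

Lemma scalar_mx_continuous (R : realType) (m n p q : nat)
    (f : {scalar ('M[R]_(m, n) * 'M[R]_(p, q))%type}) : continuous f.
Proof.
have fE : f = (fun w =>
    (\sum_i \sum_j w.1 i j * f (delta_mx i j, 0)) +
    (\sum_i \sum_j w.2 i j * f (0, delta_mx i j))) :> (_ -> R).
  apply/funext => -[A B] /=.
  have -> : (A, B) = (A, 0) + (0, B) by congr (_, _); rewrite ?addr0 ?add0r.
  rewrite linearD; congr (_ + _).
    transitivity (f (\sum_i \sum_j A i j *: (delta_mx i j, 0))).
      congr (f _); rewrite [A in LHS]matrix_sum_delta.
      rewrite [RHS]surjective_pairing; congr (_, _); rewrite raddf_sum/=.
        by apply: eq_bigr => i _; rewrite raddf_sum.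
      rewrite big1// => i _; rewrite raddf_sum/= big1// => j _.
      by rewrite scaler0.
    rewrite linear_sum; apply: eq_bigr => i _; rewrite linear_sum.
    by apply: eq_bigr => j _; rewrite linearZ.
  transitivity (f (\sum_i \sum_j B i j *: (0, delta_mx i j))).
    congr (f _); rewrite [B in LHS]matrix_sum_delta.
    rewrite [RHS]surjective_pairing; congr (_, _); rewrite raddf_sum/=.
      rewrite big1// => i _; rewrite raddf_sum/= big1// => j _.
      by rewrite scaler0.
    by apply: eq_bigr => i _; rewrite raddf_sum.
  rewrite linear_sum; apply: eq_bigr => i _; rewrite linear_sum.
  by apply: eq_bigr => j _; rewrite linearZ.
have sum_cont (T : topologicalType) k (g : 'I_k -> T -> R) :
    (forall i, continuous (g i)) -> continuous (fun w => \sum_i g i w).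
  move=> g_cont; apply: (@continuous_big R _ +%R 0 xpredT) => //.
  exact: add_continuous.
rewrite fE => w; apply: cvgD; apply: (sum_cont) => i; apply: (sum_cont) => j v;
  apply: cvgM; (try exact: cvg_cst).
- by apply: (@continuous_comp _ _ _ fst (fun M : 'M[R]_(m, n) => M i j));
    [exact: cvg_fst|exact: coord_continuous].
- by apply: (@continuous_comp _ _ _ snd (fun M : 'M[R]_(p, q) => M i j));
    [exact: cvg_snd|exact: coord_continuous].
Qed.

(** Two binary vectors whose coordinates differ by less than 1 are equal. *)
Lemma binary_locally_constant (R : realType) (n : nat) (T : topologicalType)
    (g : T -> 'rV[R]_n) (A : set T) (w : T) :
  continuous g -> (forall v, A v -> binary (g v)) -> A w ->
  \forall v \near within A (nbhs w), g v = g w.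
Proof.
move=> g_cont A_bin Aw.
have close : \forall v \near w, forall i, `|g w 0 i - g v 0 i| < 1.
  apply: filter_forall => i.
  have : (fun v => g v 0 i) v @[v --> w] --> g w 0 i.
    by apply: (@continuous_comp _ _ _ g (fun M : 'rV[R]_n => M 0 i));
      [exact: g_cont|exact: coord_continuous].
  by move/cvgr_dist_lt; apply.
rewrite near_withinE; near=> v => Av.
apply/rowP => i.
have : `|g w 0 i - g v 0 i| < 1 by move: i; near: v.
by case: (A_bin _ Aw i) => ->; case: (A_bin _ Av i) => -> //;
  rewrite ?(subr0, sub0r) ?normrN normr1 ltxx.
Unshelve. all: by end_near. Qed.

(** The arbitrary function [h] is locally constant along [A], because first
    components are binary there; the sum is thus continuous along [A]. *)
Lemma binary_min_attained (R : realType) (m n p : nat)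
    (f : {scalar ('rV[R]_m * 'M[R]_(n, p))%type}) (h : 'rV[R]_m -> R)
    (A : set ('rV[R]_m * 'M[R]_(n, p))) :
  A !=set0 -> compact A -> (forall w, A w -> binary w.1) ->
  exists2 w, A w & forall v, A v -> f w + h w.1 <= f v + h v.1.
Proof.
move=> A0 A_cpt A_bin.
have fh_cont : {within A, continuous (fun w => f w + h w.1)}.
  apply/subspace_continuousP => w Aw; apply: cvgD.
    have f_cont : {within A, continuous f}.
      exact: continuous_subspaceT (@scalar_mx_continuous R 1 m n p f).
    by move/subspace_continuousP: f_cont; apply.
  apply: cvg_near_cst.
  have fst_cont : continuous (@fst 'rV[R]_m 'M[R]_(n, p)).
    by move=> v; exact: cvg_fst.
  by apply: filterS (binary_locally_constant fst_cont A_bin Aw) => v ->.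
have [w wA w_min] := compact_EVT_min A0 A_cpt fh_cont.
by exists w => [|v Av]; [rewrite inE in wA|apply: w_min; rewrite inE].
Qed.

(** * Expectations of extended-real values *)

Lemma lty_family_le_fin (R : realType) (K : nat) (q : 'I_K -> \bar R) :
  (forall k, (q k < +oo)%E) -> exists M : R, forall k, (q k <= M%:E)%E.
Proof.
move=> q_lty; exists (\sum_k `|fine (q k)|) => k.
have := q_lty k; rewrite ltey_eq => /orP[qk|/eqP ->]; last exact: leNye.
rewrite -(fineK qk) lee_fin (le_trans (ler_norm _))// (bigD1 k)//= lerDl.
exact: sumr_ge0.
Qed.

Lemma sup_expectation_lty (R : realType) (K : nat) (q : 'I_K -> \bar R)
    (A : set 'rV[R]_K) :
  A `<=` simplex R K -> (forall k, (q k < +oo)%E) ->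
  (ereal_sup [set \sum_(k < K) (p 0%R k)%:E * q k | p in A] < +oo)%E.
Proof.
move=> A_simplex /lty_family_le_fin[M q_le].
apply: le_lt_trans (ltry M); apply: ge_ereal_sup => _ [p Ap <-].
have [p_ge0 p1] := A_simplex p Ap.
rewrite -[M]mul1r -p1 mulr_suml -sumEFin.
by apply: lee_sum => k _; rewrite EFinM; apply: lee_wpmul2l; rewrite ?lee_fin.
Qed.

(** * Duality for moment ambiguity sets *)

Section Type2Duality.
Context (R : realType) (I J K : nat) (P : program R I J K).
Context (mu : 'rV[R]_I -> 'cV[R]_J) (Sigma : 'rV[R]_I -> 'M[R]_J).

(** Normalization and the two moment equations determine the expectation of
    every function of the scenario that is affine plus linear in the scatter
    matrix; these are the functions that the multipliers describe. *)
Lemma type2_expectation (t : nat) (x : 'rV[R]_I) (p : 'rV[R]_K)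
    (s : R) (u : 'cV[R]_J) (Y : 'M[R]_J) :
  type2_ambiguity P mu Sigma t x p ->
  \sum_k p 0 k * (s + Defs.dotmx u (xi P t k)
                  + frobenius (scatter mu x (xi P t k)) Y) =
  s + Defs.dotmx u (mu x) + frobenius (Sigma x) Y.
Proof.
move=> [[_ p1] <- <-].
under eq_bigr do rewrite !mulrDr.
rewrite !big_split /= -mulr_suml p1 mul1r; congr (_ + _ + _).
  rewrite /Defs.dotmx mulmx_sumr summxE; apply: eq_bigr => k _.
  by rewrite -scalemxAr [in RHS]mxE.
rewrite /frobenius linear_sum mulmx_suml raddf_sum /=; apply: eq_bigr => k _.
by rewrite linearZ -scalemxAl mxtraceZ.
Qed.

Lemma type2_weak_duality (t : nat) (x : 'rV[R]_I) (q : 'I_K -> \bar R)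
    (s : R) (u : 'cV[R]_J) (Y : 'M[R]_J) :
  (forall k, (q k <= (s + Defs.dotmx u (xi P t k)
                      + frobenius (scatter mu x (xi P t k)) Y)%:E)%E) ->
  (ereal_sup [set \sum_(k < K) (p 0%R k)%:E * q k
             | p in type2_ambiguity P mu Sigma t x]
     <= (s + Defs.dotmx u (mu x) + frobenius (Sigma x) Y)%:E)%E.
Proof.
move=> q_le; apply: ge_ereal_sup => _ [p Ap <-].
rewrite -(type2_expectation s u Y Ap) -sumEFin.
apply: lee_sum => k _; rewrite EFinM; apply: lee_wpmul2l (q_le k).
by rewrite lee_fin; have [[p_ge0 _] _ _] := Ap.
Qed.

(** Stated with an arbitrary real upper bound [c], so that it covers a finite
    supremum, for which it gives an attained dual value, and the supremum -oo,
    for which it gives dual values below every real. *)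
Lemma type2_strong_duality (t : nat) (x : 'rV[R]_I) (q : 'I_K -> \bar R)
    (c : R) :
  (forall k, q k < +oo)%E ->
  (ereal_sup [set \sum_(k < K) (p 0%R k)%:E * q k
             | p in type2_ambiguity P mu Sigma t x] <= c%:E)%E ->
  exists s u Y,
    (forall k, (q k <= (s + Defs.dotmx u (xi P t k)
                        + frobenius (scatter mu x (xi P t k)) Y)%:E)%E) /\
    s + Defs.dotmx u (mu x) + frobenius (Sigma x) Y <= c.
Proof.
move=> q_lty sup_le.
pose W := (R^o * 'cV[R]_J * 'M[R]_J)%type.
pose pairing (z : 'cV[R]_J) (S : 'M[R]_J) (w : W) : R :=
  w.1.1 + Defs.dotmx w.1.2 z + frobenius S w.2.
have pairing_lin z S : scalar (pairing z S).
  move=> k [[s u] Y] [[s' u'] Y']; rewrite /pairing /Defs.dotmx /frobenius /=.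
  rewrite linearD linearZ mulmxDl -scalemxAl mulmxDr -scalemxAr.
  rewrite mxtraceD mxtraceZ !mxE (_ : k *: s = k * s)//.
  by move: s s'; rewrite /GRing.regular => s s'; ring.
have dot0 (z : 'cV[R]_J) : Defs.dotmx 0 z = 0 :> R.
  by rewrite /Defs.dotmx trmx0 mul0mx mxE.
have frob0 (S : 'M[R]_J) : frobenius S 0 = 0.
  by rewrite /frobenius mulmx0 mxtrace0.
(* A scenario of value -oo gets the vacuous constraint 0 <= 0, in agreement
   with [fine -oo = 0]; this keeps all K scenarios as index set. *)
pose a k w := if q k \is a fin_num
  then pairing (xi P t k) (scatter mu x (xi P t k)) w else 0.
pose r k := fine (q k).
have [||||[[s u] Y] w_feas w_le] :=
  @lp_dual_attained R W K a (pairing (mu x) (Sigma x)) r c.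
- move=> k; rewrite /a; case: (q k \is a fin_num).
    exact: pairing_lin.
  by move=> ? ? ?; rewrite /= mulr0 addr0.
- exact: pairing_lin.
- have [M q_le] := lty_family_le_fin q_lty.
  exists (M, 0, 0) => k; rewrite /a /r; case: ifPn => qk.
    by rewrite /pairing /= dot0 frob0 !addr0 -lee_fin fineK.
  by move: (q_lty k); rewrite ltey_eq (negPf qk) => /eqP ->.
- move=> p p_ge0 pE.
  (* The weight of a dropped scenario is multiplied by the zero form in [pE];
     it can thus be replaced by 0. *)
  pose p' : 'rV[R]_K := \row_k if q k \is a fin_num then p k else 0.
  have p'E (f : 'I_K -> R) :
      \sum_k p' 0 k * f k = \sum_k p k * (if q k \is a fin_num then f k else 0).
    by apply: eq_bigr => k _; rewrite mxE; case: ifP; rewrite ?mulr0 ?mul0r.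
  have {}pE w : \sum_k p' 0 k *
      pairing (xi P t k) (scatter mu x (xi P t k)) w
      = pairing (mu x) (Sigma x) w by rewrite p'E -pE.
  (* Each constraint defining the ambiguity set is read off by testing [pE] on
     a basis vector of the multiplier space. *)
  have Ap' : type2_ambiguity P mu Sigma t x p'.
    split.
    + split=> [k|]; first by rewrite mxE; case: ifP.
      have := pE (1, 0, 0); rewrite /pairing /= dot0 frob0 !addr0 => <-.
      by apply: eq_bigr => k _; rewrite dot0 frob0 !addr0 mulr1.
    + apply/colP => j; have := pE (0, delta_mx j 0, 0).
      have dotE z : Defs.dotmx (delta_mx j 0) z = z j 0 :> R.
        by rewrite /Defs.dotmx trmx_delta -rowE mxE.
      rewrite /pairing /= frob0 add0r addr0 dotE => <-.
      rewrite summxE; apply: eq_bigr => k _.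
      by rewrite frob0 add0r addr0 dotE [in LHS]mxE.
    + apply/matrixP => i j; have := pE (0, 0, delta_mx i j).
      have frobE (S : 'M[R]_J) : frobenius S (delta_mx i j) = S i j.
        rewrite /frobenius /mxtrace (bigD1 j)//= [X in _ + X]big1 => [|l lj].
          rewrite mxE addr0 (bigD1 i)//= [X in _ + X]big1 => [|l li].
            by rewrite !mxE !eqxx mulr1 addr0.
          by rewrite !mxE (negPf li) mulr0.
        by rewrite mxE big1// => m _; rewrite !mxE (negPf lj) andbF mulr0.
      rewrite /pairing /= dot0 !add0r frobE => <-.
      rewrite summxE; apply: eq_bigr => k _.
      by rewrite dot0 !add0r frobE [in LHS]mxE.
  rewrite -lee_fin; apply: le_trans sup_le; apply: ereal_sup_ubound.
  exists p' => //; rewrite -sumEFin; apply: eq_bigr => k _.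
  rewrite mxE /r EFinM; case: ifPn => qk; first by rewrite fineK.
  rewrite mul0e; move: (q_lty k); rewrite ltey_eq (negPf qk) => /eqP ->.
  by rewrite mule0.
exists s, u, Y; split=> // k.
have [qk|qk] := boolP (q k \is a fin_num).
  by have := w_feas k; rewrite /a qk -lee_fin fineK.
by move: (q_lty k); rewrite ltey_eq (negPf qk) => /eqP ->; rewrite leNye.
Qed.

End Type2Duality.

(** * Value functions *)

Section Program.
Context (R : realType) (I J K : nat) (P : program R I J K).

Lemma realizations_xi (t : nat) (k : 'I_K) :
  (1 < t)%N -> realizations P t (xi P t k).
Proof. by rewrite /realizations; case: eqP => [->|_ _] //; exists k. Qed.

Lemma feasible_state_feas (t : nat) (x : 'rV[R]_I) (z : 'cV[R]_J) xy :
  (0 < t)%N -> feasible_state P t.-1 x -> realizations P t z ->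
  feas P t x z xy -> feasible_state P t xy.1.
Proof.
by case: t => // t _ x_feas z_supp Fxy; exists x, z; split=> //; exists xy.
Qed.

(** Feasible sets are nonempty and probability weights are nonnegative with
    sum 1, so that +oo never enters the recursion; -oo may enter it through an
    empty ambiguity set. *)
Lemma value_rec_lty (n t : nat) (x : 'rV[R]_I) (z : 'cV[R]_J) :
  well_posed P -> (0 < t)%N -> (t + n)%N = horizon P ->
  feasible_state P t.-1 x -> realizations P t z ->
  (value_rec P n t x z < +oo)%E.
Proof.
move=> [P_feas P_amb].
elim: n t x z => [|n IH] t x z t_gt0 tn x_feas z_supp.
  have [|[xy Fxy] _ _] := P_feas t x z _ x_feas z_supp.
    by rewrite t_gt0 -tn leq_addr.
  apply: le_lt_trans (ltry (cost P t xy)).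
  by apply: ereal_inf_lbound; exists xy.
have t_lt : (t < horizon P)%N by rewrite -tn addnS ltnS leq_addr.
have [|[xy Fxy] _ _] := P_feas t x z _ x_feas z_supp.
  by rewrite t_gt0 ltnW.
have xy_feas := feasible_state_feas t_gt0 x_feas z_supp Fxy.
apply: le_lt_trans (ereal_inf_lbound _) _; first by exists xy.
rewrite lte_add_pinfty ?ltry//; apply: sup_expectation_lty => [|k].
  by apply: P_amb xy_feas; rewrite t_gt0.
by apply: IH => //; [rewrite addSnnS|exact: realizations_xi].
Qed.

End Program.

Theorem theorem2 (R : realType) (I J K : nat)
    (I_gt0 : (0 < I)%N) (J_gt0 : (0 < J)%N) (K_gt0 : (0 < K)%N)
    (P : program R I J K) (P_wp : well_posed P)
    (mu : 'rV[R]_I -> 'cV[R]_J) (Sigma : 'rV[R]_I -> 'M[R]_J)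
    (t : nat) (t_range : (2 <= t < horizon P)%N)
    (x : 'rV[R]_I) (x_feas : feasible_state P t.-1 x)
    (z : 'cV[R]_J) (z_supp : realizations P t z)
    (P_type2 : forall xt, Xhat P t x z xt ->
       ambiguity P t.+1 xt = type2_ambiguity P mu Sigma t.+1 xt)
    (P_neq0 : forall xt, Xhat P t x z xt ->
       type2_ambiguity P mu Sigma t.+1 xt !=set0) :
  is_optimal_value (type2_objective_values P mu Sigma t x z) (Q P t x z).
Proof.
have /andP[t_ge2 t_lt] := t_range.
have t_gt0 : (0 < t)%N by exact: ltnW.
have [|F0 F_cpt [m [A [B [c FE]]]]] := P_wp.1 t x z _ x_feas z_supp.
  by rewrite t_gt0 ltnW.
have F_bin xy : feas P t x z xy -> binary xy.1 by rewrite FE => -[].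
pose q xt k := Q P t.+1 xt (xi P t.+1 k).
have q_lty xy k : feas P t x z xy -> (q xy.1 k < +oo)%E.
  move=> Fxy; apply: value_rec_lty => //; first by rewrite subnKC.
    exact: feasible_state_feas Fxy.
  exact: realizations_xi.
pose V xt : \bar R := ereal_sup [set \sum_(k < K) (p 0 k)%:E * q xt k
  | p in type2_ambiguity P mu Sigma t.+1 xt]%E.
have QE : Q P t x z =
    ereal_inf [set (cost P t xy)%:E + V xy.1 | xy in feas P t x z]%E.
  rewrite Q_bellman//; congr (ereal_inf _); apply: eq_imagel => xy Fxy.
  by rewrite /V P_type2//; exists xy.
set D := type2_objective_values _ _ _ _ _ _.
(* For a fixed decision, a dual point of value at most any real upper bound of
   the inner supremum; by weak duality its value is itself an upper bound. *)
have dual xy r : feas P t x z xy -> (V xy.1 <= r%:E)%E ->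
    exists2 d : R, d <= r & D (cost P t xy + d)%:E /\ (V xy.1 <= d%:E)%E.
  move=> Fxy Vr.
  have [s [u [Y [feasible le_r]]]] :=
    type2_strong_duality (fun k => q_lty xy k Fxy) Vr.
  exists (s + Defs.dotmx u (mu xy.1) + frobenius (Sigma xy.1) Y) => //; split.
    case: xy {Vr le_r} Fxy feasible => xt yt Fxy feasible.
    by exists xt, yt, s, u, Y; split=> //; rewrite !addrA.
  exact: type2_weak_duality.
have Q_le xy : feas P t x z xy -> (Q P t x z <= (cost P t xy)%:E + V xy.1)%E.
  by move=> Fxy; rewrite QE; apply: ereal_inf_lbound; exists xy.
have V_lty xy : feas P t x z xy -> (V xy.1 < +oo)%E.
  move=> Fxy; apply: sup_expectation_lty => [p []//|k].
  exact: q_lty.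
have Q_infD : Q P t x z = ereal_inf D.
  apply/eqP; rewrite eq_le; apply/andP; split.
    apply: le_ereal_inf_tmp => _ [xt [yt [s [u [Y [feasible Fxy ->]]]]]].
    apply: le_trans (Q_le _ Fxy) _; rewrite -!addrA EFinD leeD2l// addrA.
    exact: type2_weak_duality.
  rewrite QE; apply: le_ereal_inf_tmp => _ [xy Fxy <-].
  have inf_le r : (V xy.1 <= r%:E)%E ->
      (ereal_inf D <= (cost P t xy)%:E + r%:E)%E.
    move=> /(dual _ _ Fxy)[d d_le [Dd _]]; apply: ge_ereal_inf.
    by exists (cost P t xy + d)%:E; rewrite // -EFinD lee_fin lerD2l.
  move: (V_lty _ Fxy); rewrite ltey_eq => /orP[Vfin|/eqP VNy].
    by rewrite -(fineK Vfin); apply: inf_le; rewrite fineK.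
  rewrite VNy addeNy leeNy_eq; apply/eqP/eq_ninfty => r.
  have := inf_le (r - cost P t xy); rewrite VNy leNye => /(_ isT).
  by rewrite -EFinD subrKC.
split=> // Qfin.
have V_fin xy : feas P t x z xy -> V xy.1 \is a fin_num.
  move=> Fxy; move: (V_lty _ Fxy); rewrite ltey_eq => /orP[//|/eqP VNy].
  by move: (Q_le _ Fxy) Qfin; rewrite VNy addeNy leeNy_eq => /eqP ->.
have [xy Fxy xy_min] :=
  binary_min_attained (cost P t) (fine \o V) F0 F_cpt F_bin.
have [|d d_le [Dd V_le]] := dual xy (fine (V xy.1)) Fxy.
  by rewrite fineK// V_fin.
suff -> : Q P t x z = (cost P t xy + d)%:E by [].
have dE : V xy.1 = d%:E.
  apply/eqP; rewrite eq_le V_le/= -(fineK (V_fin _ Fxy)) lee_fin.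
  exact: d_le.
apply/eqP; rewrite eq_le EFinD -dE Q_le//=.
rewrite QE; apply: le_ereal_inf_tmp => _ [xy' Fxy' <-].
rewrite -(fineK (V_fin _ Fxy)) -(fineK (V_fin _ Fxy')) -!EFinD lee_fin.
exact: xy_min.
Qed.
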